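(* Suppose $\phi$ is an analytic function on $\mathbb{D}$ and $C_\phi$ is a bounded composition operator on $H_h^2(\mathbb{D})$. Then $\phi$ is a self-map of $\mathbb{D}$, that is, $\phi(\mathbb{D})\subset\mathbb{D}$.
   Context: $\mathbb{D}=\{z\in\mathbb{C}:|z|<1\}$. $H_h^2(\mathbb{D})$ is the Hilbert space of complex-valued harmonic functions $f:\mathbb{D}\to\mathbb{C}$ of the form $f=h+\overline{g}$, where $h(z)=\sum_{n=0}^\infty a_nz^n$ and $g(z)=\sum_{n=0}^\infty b_nz^n$ are analytic and $\sum_{n=0}^\infty(|a_n|^2+|b_n|^2)<\infty$, with norm given in terms of these coefficients by $\|f\|_{H_h^2(\mathbb{D})}=\left(\sum_{n=0}^\infty(|a_n|^2+|b_n|^2)\right)^{1/2}$. The composition operator with symbol $\phi$ is $C_\phi f=C_\phi(h+\overline g)=(h+\overline g)\circ\phi=h\circ\phi+\overline{g\circ\phi}$ for $f=h+\overline g\in H_h^2(\mathbb{D})$. $C_\phi$ is bounded on $H_h^2(\mathbb{D})$ if it maps $H_h^2(\mathbb{D})$ into $H_h^2(\mathbb{D})$ and there is $k>0$ with $\|C_\phi f\|_{H_h^2(\mathbb{D})}\le k\|f\|_{H_h^2(\mathbb{D})}$ for all $f\in H_h^2(\mathbb{D})$. *)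

(* Defs.v *)
From Stdlib Require Import Reals Lra.
From Coquelicot Require Import Coquelicot.
Open Scope R_scope.

Definition in_disc (z : C) : Prop := Cmod z < 1.

Definition analytic_on_disc (f : C -> C) : Prop :=
  forall z : C, in_disc z -> @ex_derive C_AbsRing C_NormedModule f z.

(* Sum of [a n * z ^ n], total in [z] because Coquelicot's [Series] is: it is
   the genuine sum wherever the series converges (lemma [power_sum_correct]),
   in particular everywhere on the disc for square-summable coefficients
   (lemma [ex_power_sum]), and some default value elsewhere. *)
Definition power_sum (a : nat -> C) (z : C) : C :=
  (Series (fun n => Re (a n * z ^ n)%C), Series (fun n => Im (a n * z ^ n)%C)).

Definition sq_summable (a b : nat -> C) : Prop :=
  ex_series (fun n => Cmod (a n) ^ 2 + Cmod (b n) ^ 2).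

Definition coef_norm (a b : nat -> C) : R :=
  sqrt (Series (fun n => Cmod (a n) ^ 2 + Cmod (b n) ^ 2)).

(* [f = h + conj g] on the disc, with [a], [b] the coefficients of [h], [g].
   An element of the space is a function on the disc: values of [f] outside of
   it are ignored. *)
Definition represents (a b : nat -> C) (f : C -> C) : Prop :=
  sq_summable a b /\
  forall z : C, in_disc z -> f z = (power_sum a z + Cconj (power_sum b z))%C.

Definition in_Hh2 (f : C -> C) : Prop :=
  exists a b : nat -> C, represents a b f.

(* A function determines all of its coefficients except [a 0] and [b 0], of
   which it only determines [a 0 + conj (b 0)].  The norm of a function is
   therefore the infimum (which is attained) of the coefficient norm over its
   decompositions; this is the norm of the sum of the two function spaces [H^2]
   and [conj H^2].  Normalising [b 0 = 0] instead gives an equivalent norm, hence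
   the same bounded operators. *)
Definition Hh2_norm (f : C -> C) : R :=
  real (Glb_Rbar (fun r => exists a b : nat -> C,
                             represents a b f /\ r = coef_norm a b)).

(* [(h + conj g) o phi = h o phi + conj (g o phi)] *)
Definition comp_op (phi h g : C -> C) : C -> C :=
  fun z => (h (phi z) + Cconj (g (phi z)))%C.

(* [phi] is not assumed to map the disc to itself, and [h], [g] are composed with
   it through the sums of their power series.  Convergence of these series at the
   points [phi z] is not part of the definition: requiring it would already force
   [Cmod (phi z) < 1], since a point at which every square-summable power series
   converges lies in the disc.  The condition below is thus implied by the one in
   which each composition has to be well defined, and coincides with it as soon as
   [phi] maps the disc to itself. *)
Definition bounded_comp_op (phi : C -> C) : Prop :=
  (forall a b : nat -> C, sq_summable a b ->
     in_Hh2 (comp_op phi (power_sum a) (power_sum b))) /\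
  exists k : R, 0 < k /\
    forall (f : C -> C) (a b : nat -> C), represents a b f ->
      Hh2_norm (comp_op phi (power_sum a) (power_sum b)) <= k * Hh2_norm f.

Lemma power_sum_correct (a : nat -> C) (z l : C) :
  @is_pseries C_AbsRing C_NormedModule a z l -> power_sum a z = l.
Proof.
intros H.
assert (E : forall n, scal (pow_n (K := C_AbsRing) z n) (a n) = (a n * z ^ n)%C).
{ intros n. change (pow_n (K := C_AbsRing) z n * a n = a n * z ^ n)%C.
  apply Cmult_comm. }
unfold is_pseries in H.
assert (H' : @is_series C_AbsRing C_NormedModule (fun n => (a n * z ^ n)%C) l)
  by (eapply is_series_ext; [exact E | exact H]).
clear H E.
assert (P : forall u : nat -> C, forall n,
   sum_n (G := C_AbelianMonoid) u n =
   (sum_n (fun k => Re (u k)) n, sum_n (fun k => Im (u k)) n)).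
{ intros u n. induction n as [|n IH].
  - rewrite !sum_O. now destruct (u O).
  - rewrite !sum_Sn, IH. reflexivity. }
set (u := fun n => (a n * z ^ n)%C) in *.
destruct l as [x y]. unfold power_sum. f_equal.
- apply (is_series_unique (fun n => Re (u n))).
  apply filterlim_ext with (fun n => fst (sum_n (G := C_AbelianMonoid) u n)).
  + intros n. now rewrite P.
  + eapply filterlim_comp; [exact H'|].
    intros Q [e HQ]. exists e. intros v [Hv _]. now apply HQ.
- apply (is_series_unique (fun n => Im (u n))).
  apply filterlim_ext with (fun n => snd (sum_n (G := C_AbelianMonoid) u n)).
  + intros n. now rewrite P.
  + eapply filterlim_comp; [exact H'|].
    intros Q [e HQ]. exists e. intros v [_ Hv]. now apply HQ.
Qed.

Lemma ex_power_sum (a : nat -> C) (z : C) :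
  ex_series (fun n => Cmod (a n) ^ 2) -> in_disc z ->
  ex_series (fun n => Cmod (a n * z ^ n)%C).
Proof.
intros Ha Hz. unfold in_disc in Hz.
pose proof (Cmod_ge_0 z) as Hz0.
apply (ex_series_le (V := R_CompleteNormedModule))
  with (fun n => plus (Cmod (a n) ^ 2) ((Cmod z ^ 2) ^ n)).
- intros n. change (Rabs (Cmod (a n * z ^ n)) <= Cmod (a n) ^ 2 + (Cmod z ^ 2) ^ n).
  rewrite Rabs_pos_eq by apply Cmod_ge_0.
  rewrite Cmod_mult, Cmod_pow, <- pow_mult, Nat.mul_comm, pow_mult.
  set (x := Cmod (a n)). set (y := Cmod z ^ n).
  nra.
- apply (ex_series_plus (V := R_NormedModule)); [exact Ha|].
  apply ex_series_geom. rewrite Rabs_pos_eq; nra.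
Qed.

(* Main.v *)
Require Import Defs.
From Stdlib Require Import Reals Lra Lia.
From Coquelicot Require Import Coquelicot.

(** Evaluation at a point [z] of the disc is a bounded functional on the space
    ([Cmod_eval_le_norm], by Cauchy-Schwarz against the coefficients [z ^ n]).
    Since evaluating [f o phi] at [z] is evaluating [f] at [w = phi z],
    boundedness of the composition operator makes evaluation at [w] a bounded
    functional, at least on polynomials.  Its norm is tested on the truncated
    kernels [k_N v = sum_(n <= N) (conj w * v) ^ n]: both [k_N w] and the square of
    the coefficient norm of [k_N] equal [S_N = sum_(n <= N) |w| ^ (2 n)], so that
    [S_N <= B * sqrt S_N], i.e. the partial sums [S_N] of a geometric series of
    ratio [|w| ^ 2] are bounded.  This forces [|w| < 1].

    Polynomials have their genuine value at [w] as sums of power series even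
    though [w] is not yet known to lie in the disc.  Monomials alone would only
    give [|w| <= 1]; the truncated kernels exclude [|w| = 1] as well, since then
    [S_N = N + 1]. *)

(** * Evaluation at a point of the disc *)

Lemma ex_series_Rmult_l (c : R) (u : nat -> R) :
  ex_series u -> ex_series (fun n => c * u n).
Proof. exact (ex_series_scal (V := R_NormedModule) c u). Qed.

(** The inner product of the sum with itself is computed termwise, which turns
    the bound on a pair of real series into a single comparison of series. *)
Lemma Cmod_power_sum_le (a : nat -> C) (z : C) :
  ex_series (fun n => Cmod (a n * z ^ n)%C) ->
  Cmod (power_sum a z) <= Series (fun n => Cmod (a n * z ^ n)%C).
Proof.
set (u := fun n => (a n * z ^ n)%C); intros Hu.
assert (HR : ex_series (fun n => Re (u n))).
{ apply (ex_series_le (V := R_CompleteNormedModule)) with (2 := Hu).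
  intros n; apply re_le_Cmod. }
assert (HI : ex_series (fun n => Im (u n))).
{ apply (ex_series_le (V := R_CompleteNormedModule)) with (2 := Hu).
  intros n; eapply Rle_trans; [apply Rmax_r | apply Rmax_Cmod]. }
change (power_sum a z) with
  ((Series (fun n => Re (u n)), Series (fun n => Im (u n))) : C).
set (x := Series (fun n => Re (u n))); set (y := Series (fun n => Im (u n))).
set (m := Cmod (x, y)).
assert (Hm0 : 0 <= m) by apply Cmod_ge_0.
assert (Hm : m ^ 2 = x ^ 2 + y ^ 2).
{ unfold m, Cmod; simpl fst; simpl snd; apply pow2_sqrt; nra. }
assert (E : m ^ 2 = Series (fun n => x * Re (u n) + y * Im (u n))).
{ rewrite Series_plus, !Series_scal_l.
  - fold x y; rewrite Hm; ring.
  - now apply ex_series_Rmult_l.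
  - now apply ex_series_Rmult_l. }
assert (L : m ^ 2 <= m * Series (fun n => Cmod (u n))).
{ rewrite E, <- Series_scal_l.
  apply Rle_trans with (Rabs (Series (fun n => x * Re (u n) + y * Im (u n))));
    [apply Rle_abs|].
  assert (CS : forall n, Rabs (x * Re (u n) + y * Im (u n)) <= m * Cmod (u n)).
  { intros n; unfold m.
    apply Rle_trans with (Cmod ((x, - y)%R * u n)%C).
    - apply Rle_trans with (2 := re_le_Cmod _).
      apply Req_le; f_equal; unfold Re, Im; simpl; ring.
    - rewrite Cmod_mult; apply Rmult_le_compat_r; [apply Cmod_ge_0|].
      apply Req_le; unfold Cmod; simpl; f_equal; ring. }
  assert (Ex : ex_series (fun n => m * Cmod (u n)))
    by now apply ex_series_Rmult_l.
  apply Rle_trans with (Series (fun n => Rabs (x * Re (u n) + y * Im (u n)))).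
  - apply Series_Rabs.
    apply (ex_series_le (V := R_CompleteNormedModule)) with (2 := Ex).
    intros n; change (Rabs (Rabs (x * Re (u n) + y * Im (u n))) <= m * Cmod (u n)).
    rewrite Rabs_Rabsolu; apply CS.
  - apply Series_le; [|exact Ex].
    intros n; split; [apply Rabs_pos | apply CS]. }
assert (0 <= Series (fun n => Cmod (u n))).
{ rewrite <- (Rmult_0_l (Series (fun n => Cmod (u n)))), <- Series_scal_l.
  apply Series_le; [intros n | exact Hu].
  pose proof (Cmod_ge_0 (u n)); lra. }
change (m <= Series (fun n => Cmod (u n))); nra.
Qed.

(** Optimising the weight [s] in Young's inequality recovers Cauchy-Schwarz. *)
Lemma le_sqrt_of_young (x M G : R) :
  0 <= M -> 0 < G ->
  (forall s, 0 < s -> x <= s / 2 * M ^ 2 + G / s) ->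
  x <= sqrt (2 * G) * M.
Proof.
intros [HM | <-] HG H.
- assert (Hq : 0 < sqrt (2 * G)) by (apply sqrt_lt_R0; lra).
  assert (Eq : sqrt (2 * G) ^ 2 = 2 * G) by (apply pow2_sqrt; lra).
  set (q := sqrt (2 * G)) in *.
  (* the minimiser of the right-hand side *)
  eapply Rle_trans; [apply (H (q / M)); now apply Rdiv_lt_0_compat|].
  apply Req_le; replace G with (q ^ 2 / 2) by lra; field; lra.
- rewrite Rmult_0_r; apply Rnot_lt_le; intros Hx.
  assert (Hs : 0 < 2 * G / x) by (apply Rdiv_lt_0_compat; lra).
  specialize (H _ Hs).
  replace (G / (2 * G / x)) with (x / 2) in H by (field; lra).
  nra.
Qed.

Lemma one_minus_Cmod_sqr_pos (z : C) : in_disc z -> 0 < 1 - Cmod z ^ 2.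
Proof. unfold in_disc; intros Hz; pose proof (Cmod_ge_0 z); nra. Qed.

Lemma is_series_pow_Cmod_sqr (z : C) :
  in_disc z -> is_series (fun n => (Cmod z ^ 2) ^ n) (/ (1 - Cmod z ^ 2)).
Proof.
unfold in_disc; intros Hz; pose proof (Cmod_ge_0 z).
apply is_series_geom; rewrite Rabs_pos_eq; nra.
Qed.

Lemma coef_norm_sqr (a b : nat -> C) :
  sq_summable a b ->
  coef_norm a b ^ 2 = Series (fun n => Cmod (a n) ^ 2 + Cmod (b n) ^ 2).
Proof.
intros Hab; apply pow2_sqrt.
set (u := fun n => Cmod (a n) ^ 2 + Cmod (b n) ^ 2).
rewrite <- (Rmult_0_l (Series u)), <- Series_scal_l.
apply Series_le; [intros n | exact Hab].
assert (0 <= u n) by (unfold u; nra).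
lra.
Qed.

(** Cauchy-Schwarz for the coefficients against the powers of [z]; the factor 2
    is there because [z ^ n] is paired with [a n] and with [b n]. *)
Lemma Cmod_eval_le_coef_norm (a b : nat -> C) (f : C -> C) (z : C) :
  represents a b f -> in_disc z ->
  Cmod (f z) <= sqrt (2 * / (1 - Cmod z ^ 2)) * coef_norm a b.
Proof.
intros [Hab Hf] Hz.
pose proof (one_minus_Cmod_sqr_pos z Hz) as Hz1.
pose proof (is_series_pow_Cmod_sqr z Hz) as Hgeo.
assert (Ha : ex_series (fun n => Cmod (a n * z ^ n)%C)).
{ apply ex_power_sum; [|exact Hz].
  apply (ex_series_le (V := R_CompleteNormedModule)) with (2 := Hab).
  intros n; change (Rabs (Cmod (a n) ^ 2) <= Cmod (a n) ^ 2 + Cmod (b n) ^ 2).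
  pose proof (pow2_ge_0 (Cmod (a n))); pose proof (pow2_ge_0 (Cmod (b n))).
  rewrite Rabs_pos_eq; lra. }
assert (Hb : ex_series (fun n => Cmod (b n * z ^ n)%C)).
{ apply ex_power_sum; [|exact Hz].
  apply (ex_series_le (V := R_CompleteNormedModule)) with (2 := Hab).
  intros n; change (Rabs (Cmod (b n) ^ 2) <= Cmod (a n) ^ 2 + Cmod (b n) ^ 2).
  pose proof (pow2_ge_0 (Cmod (a n))); pose proof (pow2_ge_0 (Cmod (b n))).
  rewrite Rabs_pos_eq; lra. }
apply le_sqrt_of_young; [apply sqrt_pos | now apply Rinv_0_lt_compat |].
intros s Hs.
rewrite Hf by exact Hz.
eapply Rle_trans; [apply Cmod_triangle|].
rewrite Cmod_conj.
eapply Rle_trans;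
  [apply Rplus_le_compat; apply Cmod_power_sum_le; [exact Ha | exact Hb]|].
rewrite <- Series_plus by assumption.
rewrite coef_norm_sqr by exact Hab.
rewrite <- (is_series_unique _ _ Hgeo).
unfold Rdiv at 2; rewrite (Rmult_comm _ (/ s)), <- !Series_scal_l.
assert (E1 : ex_series (fun n => s / 2 * (Cmod (a n) ^ 2 + Cmod (b n) ^ 2)))
  by now apply ex_series_Rmult_l.
assert (E2 : ex_series (fun n => / s * (Cmod z ^ 2) ^ n))
  by (apply ex_series_Rmult_l; eexists; exact Hgeo).
rewrite <- Series_plus by assumption.
apply Series_le;
  [intros n | now apply (ex_series_plus (V := R_NormedModule))].
split; [apply Rplus_le_le_0_compat; apply Cmod_ge_0|].
rewrite !Cmod_mult, Cmod_pow, <- pow_mult, Nat.mul_comm, pow_mult.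
(* with [t = r / s], the difference of both sides is
   [s / 2 * ((x - t) ^ 2 + (y - t) ^ 2)] *)
set (x := Cmod (a n)); set (y := Cmod (b n)).
assert (Er : Cmod z ^ n = s * (Cmod z ^ n / s)) by (field; lra).
rewrite Er; set (t := Cmod z ^ n / s).
replace (/ s * (s * t) ^ 2) with (s * t ^ 2) by (field; lra).
assert (0 <= s * (x - t) ^ 2) by (apply Rmult_le_pos; [lra | apply pow2_ge_0]).
assert (0 <= s * (y - t) ^ 2) by (apply Rmult_le_pos; [lra | apply pow2_ge_0]).
nra.
Qed.

(** * The norm as an infimum *)

Lemma Hh2_norm_is_glb (f : C -> C) :
  in_Hh2 f ->
  is_glb_Rbar (fun r => exists a b, represents a b f /\ r = coef_norm a b)
    (Hh2_norm f).
Proof.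
intros (a & b & Hab); unfold Hh2_norm.
set (E := fun r => exists a b, represents a b f /\ r = coef_norm a b).
pose proof (Glb_Rbar_correct E) as [Hlb Hglb].
assert (H0 : is_lb_Rbar E 0).
{ intros r (a' & b' & _ & ->); apply sqrt_pos. }
assert (H1 := Hlb (coef_norm a b) (ex_intro _ a (ex_intro _ b (conj Hab eq_refl)))).
apply Hglb in H0.
destruct (Glb_Rbar E) as [g | |]; try easy.
Qed.

Lemma Hh2_norm_le_coef_norm (a b : nat -> C) (f : C -> C) :
  represents a b f -> Hh2_norm f <= coef_norm a b.
Proof.
intros H; destruct (Hh2_norm_is_glb f) as [Hlb _]; [now exists a, b|].
apply (Hlb (coef_norm a b)); now exists a, b.
Qed.

Lemma Cmod_eval_le_norm (f : C -> C) (z : C) :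
  in_Hh2 f -> in_disc z ->
  Cmod (f z) <= sqrt (2 * / (1 - Cmod z ^ 2)) * Hh2_norm f.
Proof.
intros Hf Hz.
assert (HK : 0 < sqrt (2 * / (1 - Cmod z ^ 2))).
{ apply sqrt_lt_R0, Rmult_lt_0_compat; [lra|].
  now apply Rinv_0_lt_compat, one_minus_Cmod_sqr_pos. }
destruct (Hh2_norm_is_glb f Hf) as [_ Hglb].
set (K := sqrt (2 * / (1 - Cmod z ^ 2))) in *.
assert (H : Cmod (f z) / K <= Hh2_norm f).
{ apply (Hglb (Finite (Cmod (f z) / K))).
  intros r (a & b & Hab & ->).
  apply (Rmult_le_reg_l K); [exact HK|].
  replace (K * (Cmod (f z) / K)) with (Cmod (f z)) by (field; lra).
  now apply Cmod_eval_le_coef_norm. }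
apply (Rmult_le_compat_l K) in H; [|lra].
now replace (K * (Cmod (f z) / K)) with (Cmod (f z)) in H by (field; lra).
Qed.

(** * Truncated kernels *)

Lemma is_series_finite_support (u : nat -> R) (N : nat) :
  (forall n, (N < n)%nat -> u n = 0) -> is_series u (sum_n u N).
Proof.
intros Hu.
apply filterlim_ext_loc with (fun _ => sum_n u N); [|apply filterlim_const].
exists N; intros n Hn; induction Hn as [|n Hn IH]; [reflexivity|].
rewrite sum_Sn, <- IH, Hu by lia.
symmetry; apply (plus_zero_r (G := R_AbelianMonoid)).
Qed.

(** The coefficients of the reproducing kernel at [w], truncated so that they
    are square-summable for [w] outside of the disc as well. *)
Definition kernel_coef (w : C) (N n : nat) : C :=
  if (n <=? N)%nat then (Cconj w ^ n)%C else 0%C.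

Lemma Cmod_kernel_coef_sqr (w : C) (N n : nat) :
  Cmod (kernel_coef w N n) ^ 2 = if (n <=? N)%nat then (Cmod w ^ 2) ^ n else 0.
Proof.
unfold kernel_coef; destruct (n <=? N)%nat.
- rewrite Cmod_pow, Cmod_conj, <- !pow_mult; f_equal; lia.
- rewrite Cmod_0; ring.
Qed.

Lemma kernel_coef_mult_pow (w : C) (N n : nat) :
  (kernel_coef w N n * w ^ n)%C = RtoC (Cmod (kernel_coef w N n) ^ 2).
Proof.
rewrite Cmod_kernel_coef_sqr; unfold kernel_coef; destruct (n <=? N)%nat.
- rewrite <- Cpow_mult_l, RtoC_pow, Cmod2_conj, Cmult_comm; reflexivity.
- apply Cmult_0_l.
Qed.

Definition kernel_sum (w : C) (N : nat) : R :=
  sum_n (fun n => Cmod (kernel_coef w N n) ^ 2) N.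

Lemma is_series_kernel_coef_sqr (w : C) (N : nat) :
  is_series (fun n => Cmod (kernel_coef w N n) ^ 2) (kernel_sum w N).
Proof.
apply is_series_finite_support; intros n Hn.
rewrite Cmod_kernel_coef_sqr.
now rewrite (proj2 (Nat.leb_gt n N) Hn).
Qed.

Lemma power_sum_kernel_coef (w : C) (N : nat) :
  power_sum (kernel_coef w N) w = RtoC (kernel_sum w N).
Proof.
unfold power_sum, RtoC; f_equal.
- rewrite <- (is_series_unique _ _ (is_series_kernel_coef_sqr w N)).
  apply Series_ext; intros n; now rewrite kernel_coef_mult_pow.
- apply is_series_unique.
  apply is_series_ext with (fun n : nat => 0).
  + intros n; now rewrite kernel_coef_mult_pow.
  + pose proof (is_series_finite_support (fun _ => 0) 0 (fun _ _ => eq_refl)) as H.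
    now rewrite sum_O in H.
Qed.

Lemma power_sum_zero (z : C) : power_sum (fun _ => 0%C) z = 0%C.
Proof.
unfold power_sum.
rewrite (Series_ext _ (fun _ => 0 * 0)), (Series_ext (fun n => Im _) (fun _ => 0 * 0)).
- now rewrite Series_scal_l, Rmult_0_l.
- intros n; rewrite Cmult_0_l; simpl; ring.
- intros n; rewrite Cmult_0_l; simpl; ring.
Qed.

Lemma is_series_kernel_norm (w : C) (N : nat) :
  is_series (fun n => Cmod (kernel_coef w N n) ^ 2 + Cmod 0 ^ 2) (kernel_sum w N).
Proof.
apply is_series_ext with (2 := is_series_kernel_coef_sqr w N).
intros n; rewrite Cmod_0; simpl; ring.
Qed.

Lemma coef_norm_kernel_coef (w : C) (N : nat) :
  coef_norm (kernel_coef w N) (fun _ => 0%C) = sqrt (kernel_sum w N).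
Proof.
unfold coef_norm; f_equal; apply is_series_unique, is_series_kernel_norm.
Qed.

Lemma kernel_sum_ge (w : C) (N : nat) : 1 <= Cmod w -> INR (S N) <= kernel_sum w N.
Proof.
intros Hw.
rewrite <- (Rmult_1_r (INR (S N))), <- sum_n_const.
unfold kernel_sum; rewrite !sum_n_Reals; apply sum_Rle.
intros n Hn; rewrite Cmod_kernel_coef_sqr, (proj2 (Nat.leb_le n N) Hn).
apply pow_R1_Rle; nra.
Qed.

(** * The composition operator *)

Theorem theorem3p2 :
  forall phi : C -> C,
    analytic_on_disc phi ->
    bounded_comp_op phi ->
    forall z : C, in_disc z -> in_disc (phi z).
Proof.
intros phi _ [Hmap (k & Hk & Hbd)] z Hz.
apply Rnot_le_lt; intros Hw; set (w := phi z) in *.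
set (K := sqrt (2 * / (1 - Cmod z ^ 2))).
assert (HK : 0 <= K) by apply sqrt_pos.
assert (Hle : forall N, sqrt (INR (S N)) <= K * k).
{ intros N.
  set (a := kernel_coef w N); set (b := fun _ : nat => 0%C).
  assert (Hab : sq_summable a b) by (eexists; apply is_series_kernel_norm).
  set (f := fun v => (power_sum a v + Cconj (power_sum b v))%C).
  assert (Hrep : represents a b f) by (split; [exact Hab | reflexivity]).
  pose proof (kernel_sum_ge w N Hw) as HS.
  assert (HN : 0 < INR (S N)) by (apply lt_0_INR; lia).
  set (S := kernel_sum w N) in *.
  assert (Hev : S <= K * (k * sqrt S)).
  { pose proof (Cmod_eval_le_norm _ z (Hmap a b Hab) Hz) as H.
    pose proof (Hbd f a b Hrep) as H1.
    pose proof (Hh2_norm_le_coef_norm a b f Hrep) as H2.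
    unfold a, b in H2; rewrite coef_norm_kernel_coef in H2; fold a b in H2.
    change (Hh2_norm f <= sqrt S) in H2.
    assert (E : Cmod (comp_op phi (power_sum a) (power_sum b) z) = S).
    { unfold comp_op; fold w; unfold a, b.
      rewrite power_sum_kernel_coef, power_sum_zero.
      replace (Cconj 0) with (RtoC 0) by (unfold Cconj, RtoC; simpl; f_equal; ring).
      rewrite Cplus_0_r, Cmod_R; apply Rabs_pos_eq; fold S; lra. }
    rewrite E in H; eapply Rle_trans; [exact H|].
    apply Rmult_le_compat_l; [exact HK|].
    eapply Rle_trans; [exact H1|]; apply Rmult_le_compat_l; lra. }
  eapply Rle_trans; [apply sqrt_le_1_alt, HS|].
  assert (HsS : 0 < sqrt S) by (apply sqrt_lt_R0; lra).
  pose proof (sqrt_sqrt S ltac:(lra)) as HSS.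
  apply Rmult_le_reg_r with (sqrt S); [exact HsS | lra]. }
destruct (INR_unbounded ((K * k) ^ 2)) as [N HN].
specialize (Hle N).
pose proof (sqrt_pos (INR (S N))) as Hs0.
pose proof (sqrt_sqrt (INR (S N)) (pos_INR _)) as HsN.
rewrite S_INR in *; nra.
Qed.
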